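(* Let $\mathcal H=\{H_i\}_{i\in I}$ be a family of atomic monoids indexed by a non-empty set $I$, and let $\mathsf P_{\mathcal H}$ be the product of $\mathcal H$ in $\mathsf{AtoMon}$. Then $$\mathscr U_k(\mathsf P_{\mathcal H})=\bigcap_{i\in I}\mathscr U_k(H_i)\qquad\text{for every }k\in\mathbb N.$$
   Context: Monoids are not assumed commutative. For a monoid $H$, $H^\times$ is the group of units. An atom of $H$ is a non-unit $a\in H$ such that $a=xy$ with $x,y\in H$ implies $x\in H^\times$ or $y\in H^\times$; $\mathscr A(H)$ is the set of atoms. $H$ is atomic if every non-unit is a (non-empty, finite) product of atoms. $\mathsf{AtoMon}$ is the category whose objects are atomic monoids and whose morphisms are the monoid homomorphisms between atomic monoids sending atoms to atoms. The product $\mathsf P_{\mathcal H}$ in $\mathsf{AtoMon}$ is the submonoid of the direct product $\prod_{i\in I}H_i$ generated by all $f$ such that either $f(i)\in H_i^\times$ for every $i\in I$, or $f(i)\in\mathscr A(H_i)$ for every $i\in I$ (with the restricted projections). For $x\in H$, the length set $\mathsf L_H(x)\subseteq\mathbb N$ is the set of all $k\in\mathbb N$ such that $x=a_1\cdots a_k$ for some $a_1,\ldots,a_k\in\mathscr A(H)$ (the empty product, $k=0$, being $1_H$). Set $\mathscr L(H):=\{\mathsf L_H(x): x\in H\}\setminus\{\emptyset\}$ and, for $k\in\mathbb N=\{0,1,2,\ldots\}$, $\mathscr U_k(H):=\bigcup\{L\in\mathscr L(H): k\in L\}$. *)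

(* Defs.v *)
From HB Require Import structures.
From mathcomp Require Import all_boot.
From mathcomp Require Import boolp classical_sets.

Set Implicit Arguments.
Unset Strict Implicit.
Unset Printing Implicit Defensive.

Local Open Scope classical_set_scope.
Local Open Scope group_scope.

(* [monoidType] carries a [choiceType] structure; this is no restriction on   *)
(* the monoids considered, since [boolp] provides one on every type.          *)

Section Factorization.
Variable H : monoidType.

Definition units : set H := [set x | exists y, x * y = 1 /\ y * x = 1].

Definition atoms : set H :=
  [set a | ~ units a /\ forall x y, a = x * y -> units x \/ units y].

Definition atomic : Prop :=
  forall x : H, ~ units x ->
    exists s : seq H,
      [/\ s <> [::], forall a, a \in s -> atoms a & x = \prod_(a <- s) a].

Definition length_set (x : H) : set nat :=
  [set k | exists s : k.-tuple H,
             (forall a, a \in s -> atoms a) /\ x = \prod_(a <- s) a].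

Definition system_of_length_sets : set (set nat) :=
  [set length_set x | x in [set: H]] `\ set0.

Definition union_of_length_sets (k : nat) : set nat :=
  \bigcup_(L in [set L | system_of_length_sets L /\ L k]) L.

Definition generated_submonoid (G : set H) : set H :=
  smallest [set M : set H | monoid_closed (mem M)] G.

Lemma generated_submonoid_closed (G : set H) :
  monoid_closed (mem (generated_submonoid G)).
Proof.
split=> [|x y /set_mem xG /set_mem yG]; apply/mem_set => M [[M1 MM] GM].
  exact: set_mem M1.
by apply/set_mem/MM; apply/mem_set; [apply: xG | apply: yG].
Qed.

End Factorization.

Section DirectProduct.
Variables (I : Type) (H : I -> monoidType).

Definition direct_product : Type := forall i, H i.

HB.instance Definition _ := Choice.on direct_product.

Definition direct_mul (f g : direct_product) : direct_product :=
  fun i => f i * g i.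
Definition direct_one : direct_product := fun i => 1.

Lemma direct_mulA : associative direct_mul.
Proof. by move=> f g h; apply: functional_extensionality_dep => i; apply: mulgA. Qed.
Lemma direct_mul1 : left_id direct_one direct_mul.
Proof. by move=> f; apply: functional_extensionality_dep => i; apply: mul1g. Qed.
Lemma direct_mulr1 : right_id direct_one direct_mul.
Proof. by move=> f; apply: functional_extensionality_dep => i; apply: mulg1. Qed.

HB.instance Definition _ :=
  isMonoid.Build direct_product direct_mulA direct_mul1 direct_mulr1.

Definition AtoMon_generators : set direct_product :=
  [set f | (forall i, units (f i)) \/ (forall i, atoms (f i))].

(* A monoid in its own right: its units, atoms and length sets are computed   *)
(* inside it, not in the ambient direct product.                              *)
Definition AtoMon_product : Type :=
  set_type (generated_submonoid AtoMon_generators).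

HB.instance Definition _ := SubChoice.on AtoMon_product.
HB.instance Definition _ :=
  SubChoice_isSubMonoid.Build direct_product _ AtoMon_product
    (generated_submonoid_closed AtoMon_generators).

End DirectProduct.

(* Main.v *)
Require Import Defs.
From mathcomp Require Import all_boot.
From mathcomp Require Import boolp classical_sets.

Local Open Scope classical_set_scope.

(** An element of [AtoMon_product H] is a product of generators, each a unit in
    every coordinate or an atom in every coordinate.  The point is that the two
    kinds cannot interfere: in an atomic monoid a factor of a unit is a unit
    ([units_factor]), so a product of generators that uses at least one
    generator of the atomic kind is a non-unit in every coordinate.  Hence an
    element of the product with one unit coordinate is a unit
    ([units_all_coordinates]), and from this the atoms of the product are
    exactly its elements that are atoms in every coordinate
    ([atoms_AtoMon_productE]).

    By [union_of_length_setsP], [n] belongs to the [k]-th union of length sets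
    iff some product of [k] atoms equals a product of [n] atoms.  Such an
    equality in the product of the family projects to one in every [H i], as
    the projections preserve atoms.  Conversely, choose such an equality in
    every [H i] independently.  The [j]-th factors on the left, for [i] ranging
    over [I], form one element of the product that is an atom in every
    coordinate, hence an atom, and likewise on the right
    ([atom_tuple_lift]); the two resulting products agree because they agree in
    every coordinate.  It is the common number of factors in all coordinates
    that makes this assembly possible. *)

Section UnitsAtoms.
Local Open Scope group_scope.
Variable H : monoidType.
Implicit Types a u v x y : H.

Lemma units1 : units (1 : H).
Proof. by exists 1; rewrite mulg1. Qed.

Lemma unitsM u v : units u -> units v -> units (u * v).
Proof.
move=> [u' [uu' u'u]] [v' [vv' v'v]]; exists (v' * u'); split.
  by rewrite mulgA -(mulgA u) vv' mulg1.
by rewrite mulgA -(mulgA v') u'u mulg1.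
Qed.

Lemma units_mulKl u x : units u -> units (u * x) -> units x.
Proof.
move=> [u' [uu' u'u]] ux.
have -> : x = u' * (u * x) by rewrite mulgA u'u mul1g.
by apply: unitsM => //; exists u.
Qed.

Lemma units_mulKr u x : units u -> units (x * u) -> units x.
Proof.
move=> [u' [uu' u'u]] xu.
have -> : x = (x * u) * u' by rewrite -mulgA uu' mulg1.
by apply: unitsM => //; exists u.
Qed.

Lemma atoms_unitMl u a : units u -> atoms a -> atoms (u * a).
Proof.
move=> uU [aN aA]; split=> [/(units_mulKl _ _ uU)//|x y uaE].
have [u' [uu' u'u]] := uU.
have [|u'x|yU] := aA (u' * x) y.
- by rewrite -mulgA -uaE mulgA u'u mul1g.
- by left; apply: units_mulKl u'x; exists u.
by right.
Qed.

Lemma atoms_unitMr u a : units u -> atoms a -> atoms (a * u).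
Proof.
move=> uU [aN aA]; split=> [/(units_mulKr _ _ uU)//|x y auE].
have [u' [uu' u'u]] := uU.
have [|xU|yu'] := aA x (y * u').
- by rewrite mulgA -auE -mulgA uu' mulg1.
- by left.
by right; apply: units_mulKr yu'; exists u.
Qed.

(** If [b * a = 1] then [a = (a * b) * a], so for an atom [a] the idempotent
    [a * b] is a unit, hence [1], and [a] would be a unit. *)
Lemma atom_linv a b : atoms a -> b * a <> 1.
Proof.
move=> [aN aA] ba1; case: (aA (a * b) a) => [||//]; first by rewrite -mulgA ba1 mulg1.
move=> [c [abc _]]; apply: aN; exists b; split=> //.
have abab : (a * b) * (a * b) = a * b by rewrite mulgA -(mulgA a) ba1 mulg1.
by rewrite -[a * b]mulg1 -abc mulgA abab.
Qed.

Hypothesis H_atomic : atomic H.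

(** If [x] were a non-unit, the last atom of a factorization of [x] would inherit
    a left inverse from [x], against [atom_linv]. *)
Lemma units_linv x y : y * x = 1 -> units x.
Proof.
move=> yx1; apply: contrapT => /H_atomic [s [+ sA xE]].
case/lastP: s sA xE => [//|s a] sA xE _.
apply: (@atom_linv a (y * \prod_(c <- s) c)); first by apply: sA; rewrite mem_rcons mem_head.
by rewrite -mulgA -[RHS]yx1 xE -cats1 big_cat big_seq1.
Qed.

(** If [(x * y) * z = 1 = z * (x * y)], then [z * x] is a left inverse of [y],
    which is therefore a unit; so then is [x]. *)
Lemma units_factor x y : units (x * y) -> units x /\ units y.
Proof.
move=> xyU; have yU : units y.
  by case: xyU => z [_ zxy]; apply: (@units_linv y (z * x)); rewrite -mulgA.
by split=> //; apply: units_mulKr xyU.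
Qed.

End UnitsAtoms.

Lemma union_of_length_setsP (H : monoidType) (k n : nat) :
  union_of_length_sets H k n <->
  exists s : k.-tuple H, exists t : n.-tuple H,
    [/\ forall j, atoms (tnth s j), forall j, atoms (tnth t j) &
        (\prod_(j < k) tnth s j = \prod_(j < n) tnth t j)%g].
Proof.
split=> [[_ [[[x _ <-] _] [s [sA ->]]] [t [tA stE]]]|[s [t [sA tA stE]]]].
  exists s, t; split=> [j|j|].
  - by apply: sA; apply: mem_tnth.
  - by apply: tA; apply: mem_tnth.
  by move: stE; rewrite !big_tuple.
have sL : length_set (\prod_(a <- s) a)%g k by exists s; split=> // a /tnthP[j ->].
exists (length_set (\prod_(a <- s) a)%g).
  by split=> //; split; [exists (\prod_(a <- s) a)%g | move=> L0; rewrite L0 in sL].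
by exists t; split=> [a /tnthP[j ->]//|]; rewrite !big_tuple.
Qed.

Section Product.
Local Open Scope group_scope.
Variables (I : Type) (H : I -> monoidType).
Local Notation P := (AtoMon_product H).
Local Notation gen := (generated_submonoid (@AtoMon_generators I H)).
Implicit Types p q : P.

Lemma AtoMon_product_prod (n : nat) (F : 'I_n -> P) i :
  val (\prod_(j < n) F j) i = \prod_(j < n) val (F j) i.
Proof. exact: (big_morph (fun p => val p i)). Qed.

Lemma AtoMon_product_inj p q : (forall i, val p i = val q i) -> p = q.
Proof. by move=> pq; apply/val_inj/functional_extensionality_dep. Qed.

Lemma AtoMon_generator_lift (f : forall i, H i) :
    (forall i, units (f i)) \/ (forall i, atoms (f i)) ->
  exists p, forall i, val p i = f i.
Proof.
move=> fG; have f_gen : gen f by move=> M [_]; apply.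
by exists (Sub (f : direct_product H) (mem_set f_gen)) => i; rewrite SubK.
Qed.

(** An element that is a unit in every coordinate has its coordinatewise inverse
    inside the submonoid, because that inverse is itself a generator. *)
Lemma units_AtoMon_productE p : units p <-> forall i, units (val p i).
Proof.
split=> [[q [pq qp]] i|pU].
  by exists (val q i); split; [rewrite -[LHS]/(val (p * q) i) pq | rewrite -[LHS]/(val (q * p) i) qp].
pose inv i := projT1 (cid (pU i)).
have invE i : val p i * inv i = 1 /\ inv i * val p i = 1 by exact: projT2 (cid (pU i)).
have [|q qE] := AtoMon_generator_lift inv.
  by left=> i; have [pi ip] := invE i; exists (val p i).
by exists q; split; apply: AtoMon_product_inj => i;
  rewrite -[LHS]/(_ * _) qE; have [] := invE i.
Qed.

(** A unit to the left of a coordinatewise atom is absorbed into it, so the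
    elements of one of these two forms are closed under multiplication, and all
    generators are among them. *)
Lemma AtoMon_product_split p :
  units p \/ exists a q : P, (forall i, atoms (val a i)) /\ p = a * q.
Proof.
pose M : set (direct_product H) := [set f | exists2 p : P, val p = f &
  units p \/ exists a q : P, (forall i, atoms (val a i)) /\ p = a * q].
suff [q /val_inj <-] : M (val p) by [].
have /set_mem := valP p; apply; split.
- split=> [|_ _ /set_mem[q1 <- q1E] /set_mem[q2 <- q2E]]; apply/mem_set.
    by exists 1 => //; left; apply: units1.
  exists (q1 * q2) => //.
  case: q1E => [q1U|[a [q [aA ->]]]]; last by right; exists a, (q * q2); rewrite mulgA.
  case: q2E => [q2U|[a [q [aA ->]]]]; first by left; apply: unitsM.
  right; exists (q1 * a), q; rewrite mulgA; split=> // i.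
  by apply: atoms_unitMl => //; apply: (units_AtoMon_productE q1).1.
move=> f fG; have [q qE] := AtoMon_generator_lift f fG.
exists q; first exact: functional_extensionality_dep.
case: fG => fG; [left|right].
  by apply/units_AtoMon_productE => i; rewrite qE.
by exists q, 1; rewrite mulg1; split=> // i; rewrite qE.
Qed.

Hypothesis H_atomic : forall i, atomic (H i).

(** A non-unit of the product has the form [a * q] with [a] an atom in every
    coordinate, and in the atomic monoid [H i] no multiple of an atom is a unit.
    So units of the product are detected in a single coordinate. *)
Lemma units_all_coordinates p i : units (val p i) -> units p.
Proof.
have [//|[a [q [aA ->]]]] := AtoMon_product_split p.
by move=> /(units_factor _ (H_atomic i))[aU _]; case: (aA i).
Qed.

Hypothesis I_nonempty : inhabited I.

(** If [p] is an atom of the product and [p = a * q] with [a] an atom in every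
    coordinate, then [q] is a unit, so every coordinate of [p] is an atom times
    a unit.  Conversely, if [p = x * y] and [val p i0] is an atom, then [x] or
    [y] is a unit in the coordinate [i0], hence a unit of the product. *)
Lemma atoms_AtoMon_productE p : atoms p <-> forall i, atoms (val p i).
Proof.
have [i0] := I_nonempty; split=> [[pN pA] i|pA]; last first.
  split=> [/units_AtoMon_productE/(_ i0)|x y pE]; first by case: (pA i0).
  by case: (pA i0) => _ /(_ (val x i0) (val y i0)) []; rewrite ?pE // => U;
    [left|right]; apply: units_all_coordinates U.
have [//|[a [q [aA pE]]]] := AtoMon_product_split p.
have [aU|qU] := pA a q pE.
  by case: (aA i) => + _; case; apply: (units_AtoMon_productE a).1.
by rewrite pE; apply: atoms_unitMr => //; apply: (units_AtoMon_productE q).1.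
Qed.

Lemma atom_tuple_lift (n : nat) (s : forall i, n.-tuple (H i)) :
    (forall i j, atoms (tnth (s i) j)) ->
  exists t : n.-tuple P, (forall j, atoms (tnth t j)) /\
    forall i j, val (tnth t j) i = tnth (s i) j.
Proof.
move=> sA.
have tE j : exists p, forall i, val p i = tnth (s i) j.
  by apply: AtoMon_generator_lift; right.
pose t := [tuple projT1 (cid (tE j)) | j < n].
have tv i j : val (tnth t j) i = tnth (s i) j by rewrite tnth_mktuple; case: cid.
by exists t; split=> // j; apply/atoms_AtoMon_productE => i; rewrite tv.
Qed.

End Product.

Theorem theorem5p8 (I : Type) (I_nonempty : inhabited I) (H : I -> monoidType)
    (H_atomic : forall i : I, atomic (H i)) (k : nat) :
  union_of_length_sets (AtoMon_product H) k
    = \bigcap_(i in [set: I]) union_of_length_sets (H i) k.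
Proof.
apply/seteqP; split=> n /=.
  move=> /union_of_length_setsP[s [t [sA tA stE]]] i _.
  apply/union_of_length_setsP.
  exists (map_tuple (fun p => val p i) s), (map_tuple (fun p => val p i) t).
  split=> [j|j|].
  - by rewrite tnth_map; apply: (atoms_AtoMon_productE _ _ H_atomic I_nonempty _).1.
  - by rewrite tnth_map; apply: (atoms_AtoMon_productE _ _ H_atomic I_nonempty _).1.
  under eq_bigr do rewrite tnth_map; under [RHS]eq_bigr do rewrite tnth_map.
  by rewrite -!AtoMon_product_prod stE.
move=> nU; have sP i := (union_of_length_setsP _ _ _).1 (nU i Logic.I).
pose s i := projT1 (cid (sP i)).
have tP i := projT2 (cid (sP i)).
pose t i := projT1 (cid (tP i)).
have stP i := projT2 (cid (tP i)).
have [|s' [s'A s'E]] := atom_tuple_lift _ _ H_atomic I_nonempty k s.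
  by move=> i; case: (stP i).
have [|t' [t'A t'E]] := atom_tuple_lift _ _ H_atomic I_nonempty n t.
  by move=> i; case: (stP i).
apply/union_of_length_setsP; exists s', t'; split=> //.
apply: AtoMon_product_inj => i; rewrite !AtoMon_product_prod.
under eq_bigr do rewrite s'E; under [RHS]eq_bigr do rewrite t'E.
by case: (stP i).
Qed.
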